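(* Let $m$ and $e$ be positive integers such that $\mathcal{L}(m,e)\neq\emptyset$, and let $P=\min\{k\in\mathbb{N}\mid N(k,G(\mathcal{L}(m)))\cap\mathcal{L}(m,e)\neq\emptyset\}$. Then $\{S\in\mathcal{L}(m,e)\mid g(S)=g(m,e)\}=N(P,G(\mathcal{L}(m)))\cap\mathcal{L}(m,e)$. Moreover, $g(m,e)=m-1+P$.
   Context: $\mathbb{N}$ denotes the set of non-negative integers. A numerical semigroup is a subset $S\subseteq\mathbb{N}$ closed under addition, with $0\in S$ and $\mathbb{N}\setminus S$ finite. The multiplicity $m(S)$ is the least positive integer belonging to $S$; the embedding dimension $e(S)$ is the cardinality of the (unique, finite) minimal system of generators of $S$; the Frobenius number $F(S)$ is the greatest integer not belonging to $S$ (so $F(\mathbb{N})=-1$); the genus $g(S)$ is the cardinality of $\mathbb{N}\setminus S$. $\mathcal{L}(m)$ is the set of all numerical semigroups $S$ with $m(S)=m$, $\mathcal{L}(m,e)$ is the set of all numerical semigroups $S$ with $m(S)=m$ and $e(S)=e$, and $g(m,e)=\min\{g(S)\mid S\in\mathcal{L}(m,e)\}$. $G(\mathcal{L}(m))$ is the directed graph with vertex set $\mathcal{L}(m)$ in which $(S,T)\in\mathcal{L}(m)\times\mathcal{L}(m)$ is an edge if $T=S\cup\{F(S)\}$. It is a tree with root $\langle m,m+1,\ldots,2m-1\rangle=\{0\}\cup\{n\in\mathbb{N}\mid n\geq m\}$, meaning that for every other vertex there is a unique directed path (sequence of consecutive edges) from it to the root. The level of a vertex is the length of the unique path connecting it to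 the root (the root has level $0$), and for $k\in\mathbb{N}$, $N(k,G(\mathcal{L}(m)))$ is the set of vertices of level $k$. *)

(* Defs.v *)
From mathcomp Require Import all_boot all_order all_algebra.
From mathcomp Require Import finmap all_classical.
Set Implicit Arguments.
Unset Strict Implicit.
Unset Printing Implicit Defensive.
Import Order.TTheory GRing.Theory Num.Theory.
Local Open Scope classical_set_scope.

Definition submonoid (S : set nat) : Prop :=
  S 0 /\ forall a b, S a -> S b -> S (a + b).

Definition numerical_semigroup (S : set nat) : Prop :=
  submonoid S /\ finite_set (~` S).

(** Least element of a nonempty set of naturals (0 by convention on [set0]). *)
Definition set_min (A : set nat) : nat :=
  xget 0 [set n | A n /\ forall k, A k -> n <= k].

Definition multiplicity (S : set nat) : nat := set_min [set n | 0 < n /\ S n].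

Definition genus (S : set nat) : nat := #|` fset_set (~` S)|.

(** [S] regarded as a set of integers. *)
Definition int_set (S : set nat) : set int := Posz @` S.

(** The maximum is taken over the integers, so that it is [-1] for [S = setT];
    it exists as soon as [~` S] is finite. *)
Definition frobenius (S : set nat) : int :=
  xget (0%R : int)
    [set z | ~ int_set S z /\ forall w, ~ int_set S w -> (w <= z)%R].

Definition generates (A S : set nat) : Prop := smallest submonoid A = S.

Definition minimal_generators (S A : set nat) : Prop :=
  generates A S /\ forall B, B `<` A -> ~ generates B S.

(** A numerical semigroup has exactly one minimal system of generators, and it
    is finite, so neither [xget] nor [fset_set] takes its default value there. *)
Definition embedding_dim (S : set nat) : nat :=
  #|` fset_set (xget set0 (minimal_generators S))|.

Definition Lm (m : nat) : set (set nat) :=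
  [set S | numerical_semigroup S /\ multiplicity S = m].

Definition Lme (m e : nat) : set (set nat) :=
  [set S | [/\ numerical_semigroup S, multiplicity S = m & embedding_dim S = e]].

Definition min_genus (m e : nat) : nat := set_min (genus @` Lme m e).

(** [T = S `|` {F(S)}] is an equality of sets of integers: no [T] satisfies it
    when [frobenius S = -1]. *)
Definition edge (m : nat) (S T : set nat) : Prop :=
  [/\ Lm m S, Lm m T & int_set T = int_set S `|` [set frobenius S]].

Definition root_semigroup (m : nat) : set nat := [set n | n = 0 \/ m <= n].

(** [p] lists the successive vertices after [S], hence [size p] is the number
    of edges of the path. *)
Definition path_to_root (m : nat) (S : set nat) (p : seq (set nat)) : Prop :=
  path (fun T U => `[< edge m T U >]) S p /\ last S p = root_semigroup m.

(** Every vertex has exactly one path to the root. *)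
Definition level (m : nat) (S : set nat) : nat :=
  size (xget [::] (path_to_root m S)).

Definition level_set (m k : nat) : set (set nat) :=
  [set S | Lm m S /\ level m S = k].

(* Main.v *)
Require Import Defs.
From mathcomp Require Import all_boot all_order all_algebra.
From mathcomp Require Import finmap all_classical.
Local Open Scope classical_set_scope.

(** Walking along an edge of G(L(m)) adjoins exactly one missing integer, so it
    lowers the genus by one ([edge_genus]).  The root misses precisely
    1, ..., m - 1, hence has genus m - 1, and therefore every path from [S] to
    the root has length [genus S - (m - 1)].  Such a path always exists
    ([path_to_root_exists]): as long as [S] is not the root, its Frobenius
    number exceeds m, and adjoining it keeps both the semigroup property and the
    multiplicity ([edge_exists]).  Thus [genus S = m - 1 + level m S]
    ([genus_level]): on L(m, e) genus and level differ by a constant, so they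
    have the same minimizers, and their minima differ by m - 1. *)

Lemma set_min_eq {A : set nat} {n : nat} :
  A n -> (forall k, A k -> n <= k) -> set_min A = n.
Proof.
move=> An nmin; apply: xget_unique => // k [Ak kmin].
by apply/eqP; rewrite eqn_leq kmin //= nmin.
Qed.

Lemma set_minP {A : set nat} :
  A !=set0 -> A (set_min A) /\ forall k, A k -> set_min A <= k.
Proof.
move=> [a Aa]; have exA : exists n, `[< A n >] by exists a; apply/asboolP.
case: (ex_minnP exA) => n /asboolP An nmin.
have nle k : A k -> n <= k by move=> Ak; apply/nmin/asboolP.
by rewrite (set_min_eq An nle).
Qed.

(** A positive value of [set_min] cannot be the default one, hence it comes from
    a nonempty set. *)
Lemma set_min_gt0 {A : set nat} : 0 < set_min A ->
  A (set_min A) /\ forall k, A k -> set_min A <= k.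
Proof.
move=> A0; apply: set_minP; apply/set0P/eqP => A_eq0; move: A0.
by rewrite /set_min xgetPN // => n; rewrite A_eq0 => -[[]].
Qed.

(** Used with [f] the genus and [g] the level, to compare the least genus on
    L(m, e) with the least level met by L(m, e). *)
Lemma set_min_addl {T : Type} (A : set T) (f g : T -> nat) (c : nat) :
  A !=set0 -> (forall x, A x -> f x = c + g x) ->
  set_min (f @` A) = c + set_min (g @` A).
Proof.
move=> [a Aa] fg.
have /set_minP[[x Ax gx] gmin] : g @` A !=set0 by exists (g a), a.
apply: set_min_eq => [|_ [y Ay <-]]; first by exists x => //; rewrite fg ?gx.
by rewrite fg // leq_add2l; apply: gmin; exists y.
Qed.

Lemma finite_set_nat_max {A : set nat} : finite_set A -> A !=set0 ->
  exists2 n, A n & forall k, A k -> k <= n.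
Proof.
move=> finA [a Aa]; have exA : exists n, `[< A n >] by exists a; apply/asboolP.
have ubA k : `[< A k >] -> k <= \max_(i <- fset_set A) i.
  by move=> /asboolP Ak; apply: leq_bigmax_seq => //; rewrite in_fset_set // inE.
case: (ex_maxnP exA ubA) => n /asboolP An nmax.
by exists n => // k Ak; apply/nmax/asboolP.
Qed.

Lemma int_setE (S : set nat) (n : nat) : int_set S (Posz n) = S n.
Proof. by apply/propext; split=> [[k Sk [<-]]|Sn] //; exists n. Qed.

Lemma frobenius_eq {S : set nat} {z : int} : ~ int_set S z ->
  (forall w, ~ int_set S w -> (w <= z)%R) -> frobenius S = z.
Proof.
move=> Sz zmax; apply: xget_unique => // w [Sw wmax].
by apply/eqP; rewrite Order.POrderTheory.eq_le zmax //= wmax.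
Qed.

Lemma frobenius_nat {S : set nat} {f : nat} : ~ S f ->
  (forall k, ~ S k -> k <= f) -> frobenius S = Posz f.
Proof.
move=> Sf fmax; apply: frobenius_eq; first by rewrite int_setE.
by case=> // k; rewrite int_setE => /fmax.
Qed.

Lemma frobenius_notin {S : set nat} :
  finite_set (~` S) -> ~ int_set S (frobenius S).
Proof.
move=> finS; have [/(finite_set_nat_max finS)[f Sf fmax]|S0] :=
  pselect (~` S !=set0); first by rewrite (frobenius_nat Sf fmax) int_setE.
(* Only S = setT is left: its Frobenius number is -1, encoded as Negz 0. *)
have ST n : S n by apply: contrapT => Sn; apply: S0; exists n.
have N1 : ~ int_set S (Negz 0) by case.
rewrite (frobenius_eq N1) //.
by case=> [n|n _]; [rewrite int_setE => /(_ (ST n)) | case: n].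
Qed.

Lemma genus_setU1 {S : set nat} {f : nat} : finite_set (~` S) -> ~ S f ->
  genus S = (genus (S `|` [set f])).+1.
Proof.
move=> finS Sf; rewrite /genus.
have SE : ~` S = f |` ~` (S `|` [set f]).
  apply/seteqP; split=> [n Sn|n [->|nSf] //].
    by have [->|nf] := pselect (n = f); [left | right=> -[]].
  by move=> Sn; apply: nSf; left.
have finSf : finite_set (~` (S `|` [set f])).
  by apply: sub_finite_set finS; rewrite SE; right.
have nf : f \notin ~` (S `|` [set f]).
  by rewrite notin_setE => nSf; apply: nSf; right.
by rewrite SE fset_setU1 // cardfsU1 in_fset_set // nf.
Qed.

Lemma genus_root (m : nat) : 0 < m -> genus (root_semigroup m) = m - 1.
Proof.
move=> m0; rewrite /genus.
have nr0 : (0 : nat) \notin ~` root_semigroup m.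
  by rewrite notin_setE //= => nr; apply: nr; left.
have IE : `I_m = 0 |` ~` root_semigroup m.
  apply/seteqP; split=> [n /= nm|n /= [->//|nr]]; last first.
    by rewrite ltnNge; apply/negP => mn; apply: nr; right.
  have [->|/eqP n0] := eqVneq n 0; first by left.
  by right => -[//|]; rewrite leqNgt nm.
have finr : finite_set (~` root_semigroup m).
  by apply: (sub_finite_set _ (finite_II m)) => n nr; rewrite IE; right.
have := card_fset_set (card_eqxx `I_m).
rewrite {1}IE fset_setU1 // cardfsU1 in_fset_set // nr0 add1n => {2}<-.
by rewrite subn1.
Qed.

Lemma Lm_multiplicity {m : nat} {S : set nat} : 0 < m -> Lm m S ->
  S m /\ forall n, S n -> 0 < n -> m <= n.
Proof.
move=> m0 [_ mS]; rewrite -mS in m0 *.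
by have [[_ Sm] mmin] := set_min_gt0 m0; split=> // n Sn n0; apply: mmin.
Qed.

Lemma edge_genus {m : nat} {S T : set nat} :
  edge m S T -> genus S = (genus T).+1.
Proof.
move=> [[[_ finS] _] _ TS].
(* The equality of sets of integers forces the Frobenius number to be natural. *)
have [f _ fE] : int_set T (frobenius S) by rewrite TS; right.
have Sf : ~ S f by rewrite -int_setE fE; apply: frobenius_notin.
have -> : T = S `|` [set f]; last exact: genus_setU1.
apply/funext => n; rewrite -int_setE TS -fE; apply/propext.
rewrite /setU /= int_setE.
by split=> [[Sn|[->]]|[Sn|->]]; [left | right | left | right].
Qed.

(** A vertex other than the root misses some integer above m, so its Frobenius
    number f exceeds m.  Since f + a > f for a > 0, such sums already lie in S,
    which makes adjoining f harmless. *)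
Lemma edge_exists {m : nat} {S : set nat} : 0 < m -> Lm m S ->
  S <> root_semigroup m -> exists T, edge m S T.
Proof.
move=> m0 LS Sroot; have [Sm mmin] := Lm_multiplicity m0 LS.
have [[[S0 Sadd] finS] _] := LS.
have [n mn Sn] : exists2 n, m <= n & ~ S n.
  apply: contrapT => Sge; apply: Sroot; apply/seteqP; split=> n.
    by case: n => [|n] Sn; [left | right; apply: mmin].
  by case=> [->//|mn]; apply: contrapT => Sn; apply: Sge; exists n.
have [f Sf fmax] := finite_set_nat_max finS (ex_intro _ n Sn).
have Sgt k : f < k -> S k.
  by move=> fk; apply: contrapT => /fmax; rewrite leqNgt fk.
have mf : m <= f := leq_trans mn (fmax n Sn).
have Sfadd a : (S `|` [set f]) (f + a).
  case: a => [|a]; first by right; rewrite /= addn0.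
  by left; apply: Sgt; rewrite addnS ltnS leq_addr.
exists (S `|` [set f]); split=> //.
- split; first split; first split; first by left.
  + move=> a b [Sa|->]; last by move=> _; apply: Sfadd.
    by case=> [Sb|->]; [left; apply: Sadd | rewrite addnC; apply: Sfadd].
  + by apply: sub_finite_set finS => k nSf Sk; apply: nSf; left.
  + apply: set_min_eq => [|k [k0 [Sk|->//]]]; last exact: mmin.
    by split=> //; left.
- rewrite (frobenius_nat Sf fmax); apply/seteqP; split=> z.
    by case=> k [Sk|->] <-; [left; exists k | right].
  by case=> [[k Sk <-]|->]; [exists k => //; left | exists f => //; right].
Qed.

Lemma path_to_root_exists {m : nat} {S : set nat} : 0 < m -> Lm m S ->
  exists p, path_to_root m S p.
Proof.
move=> m0; move: {2}(genus S) (erefl (genus S)) => n.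
elim: n S => [|n IHn] S gS LS.
all: have [->|Sroot] := pselect (S = root_semigroup m); first by exists [::].
all: have [T ST] := edge_exists m0 LS Sroot; move: gS; rewrite (edge_genus ST) //.
case=> gT; have [_ LT _] := ST; have [p [pT pl]] := IHn _ gT LT.
by exists (T :: p); split=> //=; rewrite pT andbT; apply/asboolP.
Qed.

Lemma genus_path_to_root {m : nat} {S : set nat} {p : seq (set nat)} :
  0 < m -> path_to_root m S p -> genus S = m - 1 + size p.
Proof.
move=> m0; elim: p S => [S [_ /= ->]|T p IHp S]; first by rewrite genus_root ?addn0.
case=> /= /andP[/asboolP ST pT] pl.
by rewrite (edge_genus ST) (IHp T) // addnS.
Qed.

(** Every path to the root has the same length, so it does not matter which one
    defines the level. *)
Lemma genus_level {m : nat} {S : set nat} : 0 < m -> Lm m S ->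
  genus S = m - 1 + level m S.
Proof.
move=> m0 LS; apply: (genus_path_to_root m0).
by apply: xgetPex; apply: path_to_root_exists.
Qed.

Lemma Lme_Lm {m e : nat} {S : set nat} : Lme m e S -> Lm m S.
Proof. by case. Qed.

Theorem corollary5 (m e : nat) (hm : 0 < m) (he : 0 < e)
    (hne : Lme m e !=set0) :
  let P := set_min [set k | level_set m k `&` Lme m e !=set0] in
  [set S | Lme m e S /\ genus S = min_genus m e] = level_set m P `&` Lme m e
  /\ min_genus m e = m - 1 + P.
Proof.
move=> P.
have PE : P = set_min (level m @` Lme m e).
  congr set_min; apply/seteqP; split=> k.
    by case=> S [[_ Sk] LS]; exists S.
  by case=> S LS Sk; exists S; split=> //; split=> //; apply: Lme_Lm LS.
have gP : min_genus m e = m - 1 + P.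
  rewrite PE; apply: set_min_addl => // S LS.
  exact: genus_level hm (Lme_Lm LS).
split=> //; rewrite gP; apply/seteqP; split=> S.
  case=> LS; rewrite (genus_level hm (Lme_Lm LS)) => /addnI SP.
  by split=> //; split=> //; apply: Lme_Lm LS.
by case=> -[LS SP] LeS; split=> //; rewrite (genus_level hm LS) SP.
Qed.
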